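(* Let $F$ be a field of characteristic $2$ and let $n>2$. Then $\mathfrak{sl}(n,F)$ is not isomorphic to $L(f)$ for any bilinear form $f:V\times V\to F$ on a non-zero finite dimensional vector space $V$ over $F$.
   Context: $L(f)=\{x\in\mathfrak{gl}(V)\mid f(xv,w)=-f(v,xw)\ \text{for all } v,w\in V\}$, a Lie subalgebra of $\mathfrak{gl}(V)$. *)

(* Defs.v *)
From HB Require Import structures.
From mathcomp Require Import all_boot all_algebra.
From mathcomp Require Import boolp.

Set Implicit Arguments.
Unset Strict Implicit.
Unset Printing Implicit Defensive.

Import GRing.Theory.
Local Open Scope ring_scope.

HB.mixin Record isLieAlgebra (F : fieldType) L & GRing.Lmodule F L := {
  lie : L -> L -> L;
  lie_linearl : forall y, linear (lie^~ y);
  lie_linearr : forall x, linear (lie x);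
  liexx : forall x, lie x x = 0;
  lie_jacobi : forall x y z,
    lie x (lie y z) + lie y (lie z x) + lie z (lie x y) = 0
}.

#[short(type="lieAlgType")]
HB.structure Definition LieAlgebra (F : fieldType) :=
  {L of isLieAlgebra F L & GRing.Lmodule F L}.

HB.mixin Record isLieClosed (F : fieldType) (L : lieAlgType F)
    (S : {pred L}) := {
  rpred_lie : {in S &, forall x y, lie x y \in S}
}.

#[short(type="lieSubalg")]
HB.structure Definition LieSubalgebra (F : fieldType) (L : lieAlgType F) :=
  {S of isLieClosed F L S & @GRing.SubmodClosed F L S}.

Section LieSubalgebraType.
Variables (F : fieldType) (L : lieAlgType F) (S : lieSubalg L).

Record lie_sub := LieSub {lie_val : L; lie_valP : lie_val \in S}.

HB.instance Definition _ := [isSub for lie_val].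
HB.instance Definition _ := [Choice of lie_sub by <:].
HB.instance Definition _ := [SubChoice_isSubLmodule of lie_sub by <:].

Definition lie_sub_bracket (x y : lie_sub) : lie_sub :=
  LieSub (rpred_lie _ _ (lie_valP x) (lie_valP y)).

Fact lie_sub_linearl y : linear (lie_sub_bracket^~ y).
Proof. by move=> a u v; apply: val_inj; apply: lie_linearl. Qed.

Fact lie_sub_linearr x : linear (lie_sub_bracket x).
Proof. by move=> a u v; apply: val_inj; apply: lie_linearr. Qed.

Fact lie_subxx x : lie_sub_bracket x x = 0.
Proof. by apply: val_inj; apply: liexx. Qed.

Fact lie_sub_jacobi x y z :
  lie_sub_bracket x (lie_sub_bracket y z)
  + lie_sub_bracket y (lie_sub_bracket z x)
  + lie_sub_bracket z (lie_sub_bracket x y) = 0.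
Proof. by apply: val_inj; apply: lie_jacobi. Qed.

HB.instance Definition _ := isLieAlgebra.Build F lie_sub
  lie_sub_linearl lie_sub_linearr lie_subxx lie_sub_jacobi.

End LieSubalgebraType.

Definition lie_isomorphic (F : fieldType) (L1 L2 : lieAlgType F) : Prop :=
  exists phi : {linear L1 -> L2},
    bijective phi /\ {morph phi : x y / lie x y}.

Fact jacobi_cancel (U : zmodType) (a b c d e g : U) :
  (a - b - (c - d)) + (c - e - (g - b)) + (g - d - (a - e)) = 0.
Proof.
have swap p q r s : p - q - (r - s) = (p + s) - (r + q) :> U.
  by rewrite opprB addrACA -opprD [q + r]addrC.
have tele p q r : (p - q) + (q - r) + (r - p) = 0 :> U.
  by rewrite !addrA !subrK subrr.
by rewrite !swap tele.
Qed.

Section GeneralLinearEnd.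
Variables (F : fieldType) (V : vectType F).
Implicit Types x y z : 'End(V).

Let lfunsE := (add_lfunE, opp_lfunE, scale_lfunE, comp_lfunE).

(* The parentheses matter: \o and - have the same precedence level in %VF.     *)
Definition gl_bracket x y : 'End(V) := (x \o y)%VF - (y \o x)%VF.

Fact gl_linearl y : linear (gl_bracket^~ y).
Proof.
move=> a u v; apply/lfunP=> w; rewrite /gl_bracket !lfunsE.
by rewrite linearP scalerBr opprD addrACA.
Qed.

Fact gl_linearr x : linear (gl_bracket x).
Proof.
move=> a u v; apply/lfunP=> w; rewrite /gl_bracket !lfunsE.
by rewrite linearP scalerBr opprD addrACA.
Qed.

Fact gl_xx x : gl_bracket x x = 0.
Proof. exact: subrr. Qed.

Fact gl_jacobi x y z :
  gl_bracket x (gl_bracket y z) + gl_bracket y (gl_bracket z x)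
  + gl_bracket z (gl_bracket x y) = 0.
Proof.
apply/lfunP=> v; rewrite /gl_bracket !lfunsE.
by rewrite zero_lfunE (linearB x) (linearB y) (linearB z); apply: jacobi_cancel.
Qed.

HB.instance Definition _ := isLieAlgebra.Build F 'End(V)
  gl_linearl gl_linearr gl_xx gl_jacobi.

End GeneralLinearEnd.

Section GeneralLinearMatrix.
Variables (F : fieldType) (n : nat).
Implicit Types x y z : 'M[F]_n.

Definition glmx_bracket x y : 'M[F]_n := x *m y - y *m x.

Fact glmx_linearl y : linear (glmx_bracket^~ y).
Proof.
move=> a u v; rewrite /glmx_bracket mulmxDl mulmxDr.
by rewrite -scalemxAl -scalemxAr scalerBr opprD addrACA.
Qed.

Fact glmx_linearr x : linear (glmx_bracket x).
Proof.
move=> a u v; rewrite /glmx_bracket mulmxDl mulmxDr.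
by rewrite -scalemxAl -scalemxAr scalerBr opprD addrACA.
Qed.

Fact glmx_xx x : glmx_bracket x x = 0.
Proof. exact: subrr. Qed.

Fact glmx_jacobi x y z :
  glmx_bracket x (glmx_bracket y z) + glmx_bracket y (glmx_bracket z x)
  + glmx_bracket z (glmx_bracket x y) = 0.
Proof.
rewrite /glmx_bracket !mulmxBl !mulmxBr !mulmxA.
exact: jacobi_cancel.
Qed.

HB.instance Definition _ := isLieAlgebra.Build F 'M[F]_n
  glmx_linearl glmx_linearr glmx_xx glmx_jacobi.

End GeneralLinearMatrix.

Section SpecialLinear.
Variables (F : fieldType) (n : nat).

Definition sl_pred : {pred 'M[F]_n} := [pred x | \tr x == 0].

Fact sl_submod_closed : submod_closed sl_pred.
Proof.
split=> [|a u v]; rewrite !inE ?mxtrace0 // mxtraceD mxtraceZ.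
by move=> /eqP-> /eqP->; rewrite mulr0 addr0.
Qed.

Fact sl_lie_closed : {in sl_pred &, forall x y, lie x y \in sl_pred}.
Proof. by move=> x y _ _; rewrite inE raddfB /= mxtrace_mulC subrr. Qed.

HB.instance Definition _ :=
  GRing.isSubmodClosed.Build F 'M[F]_n sl_pred sl_submod_closed.
HB.instance Definition _ :=
  isLieClosed.Build F 'M[F]_n sl_pred sl_lie_closed.

Definition sl : lieAlgType F := lie_sub sl_pred.

End SpecialLinear.

Section LieAlgebraOfForm.
Variables (F : fieldType) (V : vectType F) (f : {biscalar V}).

(* Membership quantifies over all of V, so it is made boolean classically,     *)
(* with `[< _ >]. The form f is arbitrary, possibly degenerate and neither     *)
(* symmetric nor alternating.                                                  *)
Definition L_pred : {pred 'End(V)} :=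
  [pred x : 'End(V) | `[< forall v w, f (x v) w = - f v (x w) >]].

Fact L_submod_closed : submod_closed L_pred.
Proof.
split=> [|a x y].
  by rewrite inE; apply/asboolP=> v w; rewrite !lfunE linear0l linear0r oppr0.
rewrite !inE => /asboolP Lx /asboolP Ly; apply/asboolP=> v w.
rewrite !lfunE /= !lfunE /= linearDl linearDr linearZl_LR linearZr_LR /=.
by rewrite Lx Ly opprD mulrN.
Qed.

Fact L_lie_closed : {in L_pred &, forall x y, lie x y \in L_pred}.
Proof.
move=> x y; rewrite !inE => /asboolP Lx /asboolP Ly; apply/asboolP=> v w.
rewrite /lie /= !lfunE /= !lfunE /= !lfunE /= linearBl linearBr /=.
by rewrite Lx Ly Ly Lx !opprK opprB.
Qed.

HB.instance Definition _ :=
  GRing.isSubmodClosed.Build F 'End(V) L_pred L_submod_closed.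
HB.instance Definition _ :=
  isLieClosed.Build F 'End(V) L_pred L_lie_closed.

Definition L : lieAlgType F := lie_sub L_pred.

End LieAlgebraOfForm.

(* Main.v *)
Require Import Defs.
From HB Require Import structures.
From mathcomp Require Import all_boot all_algebra.
From mathcomp Require Import boolp.

Set Implicit Arguments.
Unset Strict Implicit.
Unset Printing Implicit Defensive.

Import GRing.Theory.
Local Open Scope ring_scope.

(** Why sl(n, F) is never an L(f) in characteristic 2, for n > 2.

    In characteristic 2 membership in L(f) reads f(xv, w) = f(v, xw), so x is
    self-adjoint rather than skew-adjoint.  Two consequences: the identity of
    V lies in L(f), and if x and y in L(f) commute, then the composite xy lies
    in L(f) (L_pred_id, L_pred_comp).  Hence an isomorphism
    of sl(n, F) onto L(f) gives an injective linear map T from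
    sl(n, F) to an associative algebra A that turns brackets into commutators
    and whose image contains 1 and the products of its commuting elements.
    No such T exists (no_commutatively_closed_image):

    - If n is odd, the element mapped to 1 is central, but sl(n, F) has zero
      centre.  Hence n is even, and n >= 4.

    - Write E_pq = T(e_pq) for p != q, and H_ij = T(e_ii - e_jj).  Take i, j,
      k, l distinct.  Since H_ij and H_ik commute, H_ij H_ik = T(z) for some z,
      and z commutes with every e_ii - e_jj, so z is diagonal, say
      z = diag(d).  If E_pq commutes with H_ij while [H_ik, E_pq] = E_pq, then
      taking the commutator of T(z) with E_pq gives
      H_ij E_pq = (d_p + d_q) E_pq.  Modulo 2 this applies to {p, q} = {i, j}
      and to {p, q} = {k, l}.  Moreover d is constant outside {i, j, k}, so,
      n being even, tr z = 0 says that d_i + d_j = d_k + d_l; call it a.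

    - As [E_pq, E_qp] = H_pq, it follows that H_ij H_ij = a H_ij and
      H_ij H_kl = a H_kl.  Exchanging the two pairs, H_kl H_ij = b H_ij for
      some b.  The two products agree, and H_ij, H_kl are linearly
      independent, so a = 0 and H_ij squares to 0.  Then
      [H_ij, E_ik] = E_ik makes H_ij and E_ik anticommute, that is, commute,
      so that E_ik = 0, against the injectivity of T. *)

(** * Root vectors and coroots of the special linear algebra *)

Lemma exists_notin (T : finType) (s : seq T) :
  (size s < #|T|)%N -> exists x, x \notin s.
Proof.
move=> lt_s; apply/existsP; apply: contraLR lt_s.
rewrite negb_exists -leqNgt => /forallP s_full.
apply: leq_trans (card_size s); apply/subset_leq_card/subsetP=> x _.
by have := s_full x; rewrite negbK.
Qed.

Lemma lie_diag_delta (F : fieldType) n (d : 'rV[F]_n) p q :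
  lie (diag_mx d) (delta_mx p q) = (d 0 p - d 0 q) *: delta_mx p q.
Proof.
rewrite /lie /= /glmx_bracket mul_diag_mx mul_mx_diag.
apply/matrixP=> a b; rewrite !mxE.
case: eqP => [->|_] /=; last by rewrite !(mulr0, mul0r) subrr.
by case: eqP => [->|_] /=; rewrite !(mulr0, mul0r, mulr1, mul1r) ?subrr.
Qed.

Section SpecialLinearBasis.
Variables (F : fieldType) (n : nat).
Implicit Types (i j p q : 'I_n) (z : sl F n).

(** The value is [delta_mx p q] when [p != q]; the default 0 is reached only
    for [p = q], where the matrix unit has trace 1. *)
Definition sl_e p q : sl F n := insubd (0 : sl F n) (delta_mx p q).

(** The matrix e_ii - e_jj, given by its diagonal so that brackets with it are
    instances of [lie_sl_diag]. *)
Definition sl_h i j : sl F n :=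
  insubd (0 : sl F n) (diag_mx (delta_mx 0 i - delta_mx 0 j)).

Lemma val_sl_e p q : p != q -> val (sl_e p q) = delta_mx p q.
Proof.
move=> neq_pq; apply: insubdK; rewrite !inE /mxtrace big1 // => k _.
by rewrite mxE; case: eqP => // ->; rewrite (negPf neq_pq).
Qed.

Lemma val_sl_h i j : val (sl_h i j) = diag_mx (delta_mx 0 i - delta_mx 0 j).
Proof.
have sum_delta k : \sum_(m < n) (m == k)%:R = 1 :> F.
  by rewrite (bigD1 k) //= eqxx big1 ?addr0 // => m /negPf->.
apply: insubdK; rewrite !inE mxtrace_diag.
under eq_bigr do rewrite !mxE !eqxx /=.
by rewrite sumrB !sum_delta subrr.
Qed.

Lemma sl_e_neq0 p q : p != q -> sl_e p q != 0.
Proof.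
move=> neq_pq; apply/eqP=> /(congr1 val); rewrite val_sl_e //=.
by move/matrixP/(_ p q)/eqP; rewrite !mxE !eqxx oner_eq0.
Qed.

Lemma lie_sl_diag z (d : 'rV[F]_n) p q : val z = diag_mx d -> p != q ->
  lie z (sl_e p q) = (d 0 p - d 0 q) *: sl_e p q.
Proof.
move=> zE neq_pq; apply: val_inj; rewrite /= val_sl_e //.
by rewrite -lie_diag_delta -zE -val_sl_e.
Qed.

Lemma lie_sl_h i j p q : p != q ->
  lie (sl_h i j) (sl_e p q)
    = ((p == i)%:R - (p == j)%:R - ((q == i)%:R - (q == j)%:R)) *: sl_e p q.
Proof.
move=> neq_pq; rewrite (lie_sl_diag (val_sl_h i j)) // !mxE.
by rewrite !eqxx.
Qed.

Lemma lie_sl_hh i j p q : lie (sl_h i j) (sl_h p q) = 0.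
Proof.
apply: val_inj; rewrite /= !val_sl_h /lie /= /glmx_bracket.
by rewrite [X in X - _]diag_mxC subrr.
Qed.

Lemma lie_sl_e p q : p != q -> lie (sl_e p q) (sl_e q p) = sl_h p q.
Proof.
move=> neq_pq; apply: val_inj; rewrite /= val_sl_h !val_sl_e // 1?eq_sym //.
rewrite /lie /= /glmx_bracket !mul_delta_mx.
have diag_delta k : diag_mx (delta_mx 0 k) = delta_mx k k :> 'M[F]_n.
  apply/matrixP=> a b; rewrite !mxE eqxx /= -mulrnA mulnb.
  by case: (a =P k) => //= ->; rewrite eq_sym.
by rewrite linearB /= !diag_delta.
Qed.

(** For i, j, k distinct, the (i, k) entry of the bracket of z with e_ii - e_jj
    is - z_ik.  A third index j exists for each i != k because n > 2; with n = 2
    and characteristic 2 the only candidate e_00 - e_11 is scalar. *)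
Lemma sl_diagP z : (2 < n)%N -> (forall i j, lie z (sl_h i j) = 0) ->
  exists2 d : 'rV[F]_n, val z = diag_mx d & \sum_i d 0 i = 0.
Proof.
move=> n_gt2 hz0.
have /diag_mxP[d zd] : is_diag_mx (val z).
  apply/is_diag_mxP=> i k neq_ik.
  have [j] : exists j, j \notin [:: i; k].
    by apply: exists_notin; rewrite card_ord.
  rewrite !inE negb_or => /andP[ji jk].
  move/(congr1 val): (hz0 i j); rewrite /= val_sl_h /lie /= /glmx_bracket.
  rewrite mul_diag_mx mul_mx_diag => /subr0_eq/matrixP/(_ i k).
  rewrite !mxE !eqxx /= [k == i]eq_sym [k == j]eq_sym (negPf jk).
  rewrite [i == j]eq_sym (negPf ji) -val_eqE (negPf neq_ik).
  by rewrite !subr0 mulr0 mul1r.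
exists d => //; apply/eqP; rewrite -mxtrace_diag -zd.
by have := lie_valP z; rewrite inE.
Qed.

End SpecialLinearBasis.

(** * Images of the special linear algebra closed under commuting products *)

Section CommutativelyClosedImage.
Variables (F : fieldType) (n : nat) (A : algType F).
Hypotheses (charF : 2%N \in [pchar F]) (n_gt2 : (2 < n)%N).
Variable T : {linear sl F n -> A}.
Hypothesis T_inj : injective T.
Hypothesis T_lie : forall x y, T (lie x y) = T x * T y - T y * T x.
Hypothesis T_one : exists c, T c = 1.
Hypothesis T_mul : forall x y, T x * T y = T y * T x ->
  exists z, T z = T x * T y.

Let T_neq0 x : x != 0 -> T x != 0.
Proof. by apply: contraNneq => /eqP; rewrite raddf_eq0. Qed.

Let addFF (a : F) : a + a = 0. Proof. exact: addrr_pchar2. Qed.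
Let subE (a b : F) : a - b = b + a. Proof. by rewrite addrC oppr_pchar2. Qed.
Let oppF (a : F) : - a = a. Proof. exact: oppr_pchar2. Qed.

Let natr_n : n%:R = (odd n)%:R :> F.
Proof.
rewrite -{1}[n]odd_double_half natrD -muln2 natrM.
by rewrite (pcharf0 charF) mulr0 addr0.
Qed.

(** The preimage of 1 is central, hence a scalar matrix d with n d = 0; for n
    odd it would vanish. *)
Lemma commutative_image_n_even : ~~ odd n.
Proof.
apply/negP=> n_odd; have [c Tc] := T_one.
have lie_c x : lie c x = 0.
  by apply: T_inj; rewrite T_lie Tc mulr1 mul1r subrr linear0.
have [d cd tr_c] := sl_diagP n_gt2 (fun i j => lie_c (sl_h F i j)).
have d_const p q : d 0 p = d 0 q.
  have [-> // | neq_pq] := eqVneq p q.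
  have /esym/eqP := lie_sl_diag cd neq_pq.
  rewrite lie_c scaler_eq0 (negPf (sl_e_neq0 _ neq_pq)) orbF subr_eq0.
  by move/eqP.
have d0 p : d 0 p = 0.
  move: tr_c; under eq_bigr => i _ do rewrite (d_const i p).
  by rewrite sumr_const card_ord -mulr_natr natr_n n_odd mulr1.
have c0 : c = 0.
  apply: val_inj; rewrite cd; apply/matrixP=> i j.
  by rewrite !mxE d0 mul0rn.
by move/eqP: Tc; rewrite c0 linear0 eq_sym oner_eq0.
Qed.

(** Commuting T(z) = T(h) T(h') past T(x) moves only the factor T(h'), which
    contributes T(x) again; what remains is T(h) T(x). *)
Lemma sl_h_mul_weight h h' x z (a : F) : T z = T h * T h' ->
  lie h x = 0 -> lie h' x = x -> lie z x = a *: x ->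
  T h * T x = a *: T x.
Proof.
move=> Tz hx h'x zx.
have h_comm : T h * T x = T x * T h.
  by apply/eqP; rewrite -subr_eq0 -T_lie hx linear0.
rewrite -linearZ -zx T_lie Tz mulrA -h_comm -!mulrA -mulrBr.
by rewrite -T_lie h'x.
Qed.

(** A coroot is the commutator of two opposite root vectors, so a left
    multiplication that scales both of these scales the coroot. *)
Lemma sl_h_mul_coroot (a : F) x p q : p != q ->
    T x * T (sl_e F p q) = a *: T (sl_e F p q) ->
    T x * T (sl_e F q p) = a *: T (sl_e F q p) ->
  T x * T (sl_h F p q) = a *: T (sl_h F p q).
Proof.
move=> pq xe_pq xe_qp; rewrite -(lie_sl_e F pq) T_lie mulrBr !mulrA xe_pq xe_qp.
by rewrite -!scalerAl scalerBr.
Qed.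

(** The product commutes with all H_pq, hence is the image of a diagonal z, and
    with E_ml for m and l outside {i, j, k}, hence d is constant there.
    The relation between the four entries is then the vanishing of the trace:
    n being even, sum_m (d_m - d_l) = 0, and only the terms for i, j, k
    remain. *)
Lemma sl_h_mul_diag i j k l : uniq [:: i; j; k; l] ->
  exists z (d : 'rV[F]_n),
    [/\ T z = T (sl_h F i j) * T (sl_h F i k), val z = diag_mx d
      & d 0 i + d 0 j = d 0 k + d 0 l].
Proof.
rewrite /= !inE !negb_or !andbT -!andbA => /and5P[ij ik il jk /andP[jl kl]].
have h_comm p q r s :
    T (sl_h F p q) * T (sl_h F r s) = T (sl_h F r s) * T (sl_h F p q).
  by apply/eqP; rewrite -subr_eq0 -T_lie lie_sl_hh linear0.
have [z Tz] := T_mul (h_comm i j i k).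
have lie_z0 x : T (sl_h F i j) * T x = T x * T (sl_h F i j) ->
    T (sl_h F i k) * T x = T x * T (sl_h F i k) -> lie z x = 0.
  move=> comm_ij comm_ik; apply: T_inj; rewrite T_lie Tz linear0.
  by rewrite -mulrA comm_ik !mulrA comm_ij subrr.
have [d zd tr_d] :=
  sl_diagP n_gt2 (fun p q => lie_z0 _ (h_comm i j p q) (h_comm i k p q)).
exists z, d; split=> //.
have d_rest m : m \notin [:: i; j; k] -> d 0 m - d 0 l = 0.
  move=> m_out; have [-> | ml] := eqVneq m l; first by rewrite subrr.
  have e_comm r s : r \in [:: i; j; k] -> s \in [:: i; j; k] ->
      T (sl_h F r s) * T (sl_e F m l) = T (sl_e F m l) * T (sl_h F r s).
    move=> r_in s_in; apply/eqP; rewrite -subr_eq0 -T_lie lie_sl_h //.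
    have neqE t : t \in [:: i; j; k] -> (m == t = false) * (l == t = false).
      move=> t_in; split; apply: contraTF t_in => /eqP<- //.
      by rewrite !inE !negb_or ![l == _]eq_sym il jl.
    by rewrite !(neqE r) ?(neqE s) // !subrr scale0r linear0.
  have := lie_sl_diag zd ml.
  rewrite lie_z0 ?e_comm ?inE ?eqxx ?orbT //.
  by move/esym/eqP; rewrite scaler_eq0 (negPf (sl_e_neq0 F ml)) orbF => /eqP.
have : \sum_m (d 0 m - d 0 l) = 0.
  rewrite sumrB tr_d sumr_const card_ord -mulr_natr natr_n.
  by rewrite (negPf commutative_image_n_even) mulr0 subrr.
rewrite (bigD1 i) //= (bigD1 j) 1?eq_sym //= (bigD1 k) /=; last first.
  by rewrite ![k == _]eq_sym ik.
rewrite big1 => [|m /andP[/andP[mi mj] mk]]; last first.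
  by rewrite d_rest // !inE !negb_or mi mj.
rewrite addr0 !subE addrA (addrACA (d 0 l) _ (d 0 l)) addFF add0r => /eqP.
by rewrite addr_eq0 oppF => /eqP->; apply: addrC.
Qed.

(** Modulo 2 the four root vectors E_ij, E_ji, E_kl, E_lk all have weight 0 for
    H_ij and weight 1 for H_ik, so that H_ij multiplies each of them by a
    scalar; the relation between the entries of d makes the scalars agree. *)
Lemma sl_h_mul_h i j k l : uniq [:: i; j; k; l] ->
  exists a : F, T (sl_h F i j) * T (sl_h F i j) = a *: T (sl_h F i j)
             /\ T (sl_h F i j) * T (sl_h F k l) = a *: T (sl_h F k l).
Proof.
move=> ijkl; have [z [d [Tz zd sum_d]]] := sl_h_mul_diag ijkl.
move: ijkl; rewrite /= !inE !negb_or !andbT -!andbA.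
case/and5P=> ij ik il jk /andP[jl kl].
(* The weight d_p - d_q is written as a sum to make it symmetric in p, q. *)
have hE p q : p != q -> lie (sl_h F i j) (sl_e F p q) = 0 ->
    lie (sl_h F i k) (sl_e F p q) = sl_e F p q ->
  T (sl_h F i j) * T (sl_e F p q) = (d 0 p + d 0 q) *: T (sl_e F p q).
  move=> pq h0 h1; apply: sl_h_mul_weight Tz h0 h1 _.
  by rewrite (lie_sl_diag zd pq) [- d 0 q]oppF.
have hE' p q : p != q -> lie (sl_h F i j) (sl_e F p q) = 0 ->
    lie (sl_h F i k) (sl_e F p q) = sl_e F p q ->
    lie (sl_h F i j) (sl_e F q p) = 0 ->
    lie (sl_h F i k) (sl_e F q p) = sl_e F q p ->
  T (sl_h F i j) * T (sl_h F p q) = (d 0 p + d 0 q) *: T (sl_h F p q).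
  move=> pq h0 h1 h0' h1'; apply: sl_h_mul_coroot (hE _ _ pq h0 h1) _ => //.
  by rewrite hE // 1?eq_sym // addrC.
have neqE := (negPf ij, negPf ik, negPf il, negPf jk, negPf jl, negPf kl).
have symE := (eq_sym j i, eq_sym k i, eq_sym l i,
              eq_sym k j, eq_sym l j, eq_sym l k).
exists (d 0 i + d 0 j); split; [|rewrite sum_d]; apply: hE' => //;
  rewrite lie_sl_h ?symE // ?eqxx ?neqE //= !subE;
  by rewrite ?(addr0, add0r, addFF, scale0r, scale1r).
Qed.

(** Left multiplication by H_ij is a scalar on both H_ij and H_kl, and the
    symmetry of H_ij H_kl forces this scalar to vanish; a square-zero H_ij
    cannot have the eigenvector E_ik of eigenvalue 1. *)
Lemma no_commutatively_closed_image : False.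
Proof.
have n_gt3 : (3 < n)%N.
  rewrite ltn_neqAle n_gt2 andbT; apply: contra commutative_image_n_even.
  by move/eqP<-.
pose I m (m_lt : (m < 4)%N) : 'I_n := Ordinal (leq_trans m_lt n_gt3).
pose i := I 0%N isT; pose j := I 1%N isT.
pose k := I 2%N isT; pose l := I 3%N isT.
have [a [hh hh']] : exists a : F, _ := @sl_h_mul_h i j k l isT.
have [b [_ h'h]] : exists b : F, _ := @sl_h_mul_h k l i j isT.
have a0 : a = 0.
  have : T (a *: sl_h F k l - b *: sl_h F i j) = 0.
    rewrite (linearB T) !(linearZ_LR T) /= -hh' -h'h -T_lie lie_sl_hh.
    exact: linear0.
  rewrite -[RHS](linear0 T) => /T_inj /(congr1 val) /=.
  (* e_ii - e_jj vanishes at (k, k), so only the coefficient a is seen there. *)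
  rewrite !val_sl_h => /matrixP/(_ k k).
  by rewrite !mxE /= mulr1n !subr0 mulr1 mulr0 subr0.
have ik : i != k by [].
have he : lie (sl_h F i j) (sl_e F i k) = sl_e F i k.
  by rewrite lie_sl_h //= !subr0 scale1r.
move: hh; rewrite a0 scale0r => hh.
move/(congr1 T): he; rewrite T_lie => he.
(* Multiply H E - E H = E by H on the left and on the right, with H H = 0. *)
have heh :
    T (sl_h F i j) * T (sl_e F i k) = - (T (sl_e F i k) * T (sl_h F i j)).
  rewrite -[in LHS]he -[in RHS]he mulrBr mulrBl !mulrA hh mul0r sub0r.
  by rewrite -[X in _ - X]mulrA hh mulr0 subr0.
have /eqP[] := T_neq0 (sl_e_neq0 F ik).
by rewrite -he heh -opprD -[_ * _]scale1r -scalerDl addFF scale0r oppr0.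
Qed.

End CommutativelyClosedImage.

(** * Self-adjoint endomorphisms in characteristic 2 *)

Section FormAlgebraChar2.
Variables (F : fieldType) (V : vectType F) (f : {biscalar V}).
Hypothesis charF : 2%N \in [pchar F].
Implicit Types x y : 'End(V).

Lemma L_pred_char2P x :
  reflect (forall v w, f (x v) w = f v (x w)) (x \in L_pred f).
Proof.
rewrite inE; apply: (iffP (asboolP _)) => fx v w.
  by rewrite fx oppr_pchar2.
by rewrite fx oppr_pchar2.
Qed.

Lemma L_pred_id : \1%VF \in L_pred f.
Proof. by apply/L_pred_char2P=> v w; rewrite !id_lfunE. Qed.

(** Moving the two factors across f reverses their order, so that the adjoint of
    the composite is the composite in the other order. *)
Lemma L_pred_comp x y : x \in L_pred f -> y \in L_pred f ->
  (x \o y = y \o x)%VF -> (x \o y)%VF \in L_pred f.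
Proof.
move=> /L_pred_char2P fx /L_pred_char2P fy xyC; apply/L_pred_char2P=> v w.
by rewrite [in RHS]xyC !comp_lfunE fx fy.
Qed.

End FormAlgebraChar2.

Theorem theorem12p3 (F : fieldType) (charF : 2%N \in [pchar F])
    (n : nat) (n_gt2 : (2 < n)%N)
    (V : vectType F) (V_neq0 : \dim {:V} != 0%N) (f : {biscalar V}) :
  ~ lie_isomorphic (sl F n) (L f).
Proof.
case=> phi [[psi phiK psiK] phi_lie].
have V_proper : (0 < dim V)%N by rewrite -dimvf lt0n.
(* The product of this algebra is composition in the reverse order; commutators
   only change sign, which is harmless in characteristic 2. *)
pose A : algType F := lfun_algType V_proper.
have mulA_E (x y : 'End(V)) : (x : A) * (y : A) = (y \o x)%VF by [].
have oppV (u : 'End(V)) : - u = u by rewrite -scaleN1r oppr_pchar2 // scale1r.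
have T_linear : linear (fun x => val (phi x) : A).
  by move=> a x y; rewrite linearP.
pose T : {linear sl F n -> A} :=
  HB.pack (fun x => val (phi x) : A)
    (GRing.isLinear.Build F (sl F n) A _ _ T_linear).
have T_im (x : 'End(V)) : x \in L_pred f -> exists z, T z = x.
  by move=> Lx; exists (psi (LieSub Lx)); rewrite /T /= psiK.
apply: (@no_commutatively_closed_image F n A charF n_gt2 T).
- exact: inj_comp val_inj (can_inj phiK).
- by move=> x y; rewrite !mulA_E /T /= phi_lie -[RHS]oppV opprB.
- by apply: T_im; apply: L_pred_id.
- move=> x y xyC; rewrite mulA_E; apply: T_im.
  by apply: L_pred_comp => //; apply: lie_valP.
Qed.
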